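(* Let $(\vec b_1,\ldots,\vec b_d)$ be an HKZ-reduced basis of a lattice of dimension $d\ge 2$, with Gram–Schmidt vectors $\vec b_1^*,\ldots,\vec b_d^*$, and let $I\subset\{1,\ldots,d\}$ be nonempty. Then $$\frac{\|\vec b_1\|^{|I|}}{\prod_{i\in I}\|\vec b_i^*\|}\le (\sqrt d)^{|I|\left(1+\log\frac{d}{|I|}\right)}\le (\sqrt d)^{\frac de+|I|}.$$
   Context: Logarithms are natural. Gram–Schmidt orthogonalisation: $\vec b_i^*=\vec b_i-\sum_{j<i}\mu_{i,j}\vec b_j^*$ with $\mu_{i,j}=\langle \vec b_i,\vec b_j^*\rangle/\|\vec b_j^*\|^2$. A basis is size-reduced if $|\mu_{i,j}|\le 1/2$ for all $j<i$. A basis is HKZ-reduced if it is size-reduced, $\vec b_1$ is a shortest nonzero lattice vector, and the projections of $\vec b_2,\ldots,\vec b_d$ orthogonally to $\vec b_1$ form an HKZ-reduced basis. *)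

(* Defs.v *)
From HB Require Import structures.
From mathcomp Require Import all_boot all_order all_algebra.
From mathcomp Require Import reals sequences exp.
Set Implicit Arguments. Unset Strict Implicit. Unset Printing Implicit Defensive.
Import Order.TTheory GRing.Theory Num.Theory.
Local Open Scope ring_scope.

Section Defs.
Variables (R : realType) (n : nat).
Notation vec := 'rV[R]_n.

Definition dotv (u v : vec) : R := \sum_(k < n) u 0 k * v 0 k.
Definition normv (u : vec) : R := Num.sqrt (dotv u u).

(* Gram--Schmidt: gs_list b k = [:: b_0^*; ...; b_(k-1)^*]  (0-indexed),
   b_k^* = b_k - sum_{j<k} mu_{k,j} b_j^*,  mu_{k,j} = <b_k,b_j^*>/||b_j^*||^2 *)
Fixpoint gs_list (b : nat -> vec) (k : nat) : seq vec :=
  match k with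
  | 0 => [::]
  | k'.+1 => let s := gs_list b k' in
             rcons s (b k' - \sum_(v <- s) (dotv (b k') v / dotv v v) *: v)
  end.
Definition gs (b : nat -> vec) (i : nat) : vec := nth 0 (gs_list b i.+1) i.
Definition mu (b : nat -> vec) (i j : nat) : R :=
  dotv (b i) (gs b j) / dotv (gs b j) (gs b j).

Definition lin_indep (d : nat) (b : nat -> vec) : Prop :=
  row_free (\matrix_(i < d, k < n) b i 0 k).

Definition lat_comb (d : nat) (b : nat -> vec) (z : 'I_d -> int) : vec :=
  \sum_(i < d) (z i)%:~R *: b i.

Definition size_reduced (d : nat) (b : nat -> vec) : Prop :=
  forall i j : nat, (j < i < d)%N -> `|mu b i j| <= 1/2.

Definition first_shortest (d : nat) (b : nat -> vec) : Prop :=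
  b 0%N != 0 /\
  forall z : 'I_d -> int, lat_comb b z != 0 -> normv (b 0%N) <= normv (lat_comb b z).

Definition proj_orth (u v : vec) : vec := v - (dotv v u / dotv u u) *: u.

Fixpoint HKZ (d : nat) (b : nat -> vec) : Prop :=
  match d with
  | 0 => True
  | d'.+1 => [/\ size_reduced d b, first_shortest d b &
                 HKZ d' (fun i => proj_orth (b 0%N) (b i.+1))]
  end.
End Defs.

(* Main.v *)
Require Import Defs.
From HB Require Import structures.
From mathcomp Require Import all_boot all_order all_algebra.
From mathcomp Require Import boolp reals sequences exp.
From mathcomp Require Import zify ring lra.
Set Implicit Arguments. Unset Strict Implicit. Unset Printing Implicit Defensive.
Import Order.TTheory GRing.Theory Num.Theory.
Local Open Scope ring_scope.

(** Let [x_i = log ||b_i^*|| / log (sqrt d)].  A rank-[m] lattice with first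
    minimum [lambda] satisfies [lambda^(2m) <= m^(m-1) det^2].  Applied to the
    projected blocks [(b_s, ..., b_t)] of the basis, whose first vector is
    shortest, this says that [x_s] is at most 1 plus the average of
    [x_(s+1), ..., x_t], for all [s < t].

    For such a sequence let [m] be the least average of a prefix, so that
    [x_1 <= 1 + m].  By induction on the length,
    [sum_i max (tau - x_i, 0) <= d * theta (tau - m)] for every [tau], where
    [theta y] is [exp (y - 1)] for [y <= 1] and [y] for [y >= 1].  With
    [tau = m + 1 - log (d / |I|)] the right-hand side is [|I|], hence
    [sum_(i in I) (m - x_i) <= |I| log (d / |I|)], which is the first
    inequality.  The second one is [log t <= t / e] at [t = d / |I|].

    In the lattice inequality, small ranks follow from
    [||b_i^*||^2 <= 4/3 ||b_(i+1)^*||^2].  For large ranks, a cube of volume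
    more than twice the determinant has a translate containing three lattice
    points, two of which are at squared distance at most [2/3 m c^2], [c] being
    the side of the cube. *)

(** * Sequences bounded by the averages of their continuations *)

Section Theta.
Variable R : realType.
Implicit Types u v w y b beta : R.

(* Convex, as the diagonal is the tangent of [expR (y - 1)] at [y = 1]. *)
Definition theta y : R := if y <= 1 then expR (y - 1) else y.
Definition theta_slope y : R := if y <= 1 then expR (y - 1) else 1.

Lemma theta_slope_bounds y :
  [/\ 0 <= theta_slope y, theta_slope y <= 1 & theta_slope y <= theta y].
Proof.
rewrite /theta_slope /theta; case: (leP y 1) => h.
  by rewrite expR_ge0 lexx expR_le1 subr_le0.
by rewrite ler01 lexx ltW.
Qed.

(** Convexity as a supporting line: monotonicity and the Lipschitz, shift and chord bounds below all
    come from it. *)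
Lemma theta_tangent u v : theta u + theta_slope u * (v - u) <= theta v.
Proof.
rewrite /theta /theta_slope; case: (leP u 1) => hu; last first.
  case: (leP v 1) => hv; last by lra.
  have := expR_ge1Dx (v - 1); lra.
have tang : expR (u - 1) * (1 + (v - u)) <= expR (v - 1).
  have -> : v - 1 = (u - 1) + (v - u) by ring.
  by rewrite (expRD (u - 1)) ler_wpM2l ?expR_ge0 ?expR_ge1Dx.
have g0 := expR_ge0 (u - 1).
case: (leP v 1) => hv; first by lra.
have g1 : expR (u - 1) <= 1 by rewrite expR_le1; lra.
have : expR (u - 1) * (1 + (1 - u)) <= 1.
  have := expR_ge1Dx (1 - u).
  move/(ler_wpM2l g0) => h; apply: (le_trans h).
  by rewrite -expRD (_ : u - 1 + (1 - u) = 0) ?expR0 //; ring.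
nra.
Qed.

Lemma theta_ge0 y : 0 <= theta y.
Proof. by case: (theta_slope_bounds y) => h1 _; exact: le_trans. Qed.

Lemma theta_ge y : y <= theta y.
Proof.
rewrite /theta; case: (leP y 1) => // _; have := expR_ge1Dx (y - 1); lra.
Qed.

Lemma maxr0_le_theta y : Num.max y 0 <= theta y.
Proof. by rewrite ge_max theta_ge theta_ge0. Qed.

Lemma theta_homo u v : u <= v -> theta u <= theta v.
Proof.
move=> uv; have := theta_tangent u v.
by case: (theta_slope_bounds u) => g0 _ _; nra.
Qed.

Lemma theta_lip u v : u <= v -> theta v - theta u <= v - u.
Proof.
move=> uv; have := theta_tangent v u.
by case: (theta_slope_bounds v) => _ g1 _; nra.
Qed.

(** The tangent at [y + beta] drops by at most [beta * theta (y + beta)] on the way back to [y], as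
    the slope is at most the value. *)
Lemma theta_shift y beta :
  0 <= beta -> (1 - beta) * theta (y + beta) <= theta y.
Proof.
move=> b0; have := theta_tangent (y + beta) y.
by case: (theta_slope_bounds (y + beta)) => _ _ g1; nra.
Qed.

Lemma theta_chord y b beta : 0 <= b <= beta -> 0 < beta ->
  theta (y + b) <= theta y + (theta (y + beta) - theta y) / beta * b.
Proof.
move=> /andP[b0 bb] b1.
have h1 := theta_tangent (y + b) y.
have h2 := theta_tangent (y + b) (y + beta).
set g := theta_slope _ in h1 h2.
rewrite -(ler_pM2l b1) mulrDr.
have -> : beta * ((theta (y + beta) - theta y) / beta * b)
   = (theta (y + beta) - theta y) * b by field; rewrite gt_eqF.
nra.
Qed.

End Theta.

Section Averages.
Variable R : realType.
Implicit Types (l p q u w : seq R).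

Lemma ex_min_prefix l : l != [::] -> exists p q (a : R),
  [/\ l = p ++ q, p != [::], \sum_(v <- p) v = a * (size p)%:R &
      forall p' q', l = p' ++ q' -> a * (size p')%:R <= \sum_(v <- p') v].
Proof.
rewrite -size_eq0 -lt0n => sl.
pose avg (t : 'I_(size l)) := (\sum_(v <- take t.+1 l) v) / t.+1%:R.
have [t _ tmin] := @Order.TotalTheory.arg_minP _ R 'I_(size l) (Ordinal sl) predT avg erefl.
exists (take t.+1 l), (drop t.+1 l), (avg t).
have szt : size (take t.+1 l) = t.+1 by rewrite size_takel.
split; rewrite ?cat_take_drop // ?szt ?divfK ?pnatr_eq0 //.
  by rewrite -size_eq0 szt.
move=> p' q' lE; case: p' lE => [|v p'] lE; first by rewrite big_nil mulr0.
have pl : (size p' < size l)%N by rewrite lE /= size_cat; lia.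
have tE : take (size p').+1 l = v :: p' by rewrite lE /= take_size_cat.
have := tmin (Ordinal pl) isT.
by rewrite {2}/avg [nat_of_ord (Ordinal _)]/= tE ler_pdivlMr ?ltr0n.
Qed.

(* An HKZ profile satisfies this once logarithms are taken to base [sqrt d]. *)
Definition balanced l := forall a v u w, l = a ++ v :: u ++ w -> u != [::] ->
  (v - 1) * (size u)%:R <= \sum_(z <- u) z.

Lemma balanced_catl p q : balanced (p ++ q) -> balanced p.
Proof.
by move=> h a v u w E; apply: (h a v u (w ++ q)); rewrite E -catA /= -catA.
Qed.

Lemma balanced_catr p q : balanced (p ++ q) -> balanced q.
Proof.
by move=> h a v u w E; apply: (h (p ++ a) v u w); rewrite E -catA.
Qed.

Variable tau : R.
(** The largest sum of [tau - v] over a subset of the entries: bounding it handles every index set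
    at once. *)
Definition deficit l : R := \sum_(v <- l) Num.max (tau - v) 0.

Lemma deficit_cat p q : deficit (p ++ q) = deficit p + deficit q.
Proof. by rewrite /deficit big_cat. Qed.

Let deficit_bound l := balanced l -> forall m : R,
  (forall p q, l = p ++ q -> m * (size p)%:R <= \sum_(v <- p) v) ->
  deficit l <= theta (tau - m) * (size l)%:R.

(** The majorant of [theta (tau - v)] is affine so that the bounds on successive pieces of [l] add
    up to a function of its length and sum. *)
Let deficit_affine l := balanced l -> forall al M e f : R,
  (forall p q, l = p ++ q -> al * (size p)%:R <= \sum_(v <- p) v) ->
  (forall p q, l = p ++ q -> \sum_(v <- q) v <= M * (size q)%:R) ->
  (forall v, al <= v <= M -> theta (tau - v) <= e + f * v) ->
  deficit l <= e * (size l)%:R + f * \sum_(v <- l) v.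

Lemma natr_gt0_size l : l != [::] -> 0 < (size l)%:R :> R.
Proof. by rewrite ltr0n lt0n size_eq0. Qed.

(* Cutting [l] at its minimal-average prefix reduces the
   affine bound to [deficit_bound] on that prefix, as the average of the
   prefix lies in [[al, M]]. *)
Lemma deficit_affine_step n :
  (forall l, (size l <= n)%N -> deficit_bound l) ->
  forall l, (size l <= n)%N -> deficit_affine l.
Proof.
move=> Pn l; have [k] := ubnP (size l).
elim: k l => // k IH l ltk ltn bal al M e f hpre hsuf haff.
have [->|l0] := eqVneq l [::].
  by rewrite /deficit !big_nil !mulr0 addr0.
have [p [q [a [lE p0 pa amin]]]] := ex_min_prefix l0.
have szp := natr_gt0_size p0; have szl := natr_gt0_size l0.
have la : al <= a by rewrite -(ler_pM2r szp) -pa; exact: hpre lE.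
have aM : a <= M.
  rewrite -(ler_pM2r szl); apply: le_trans (hsuf [::] l erefl).
  by apply: (amin l [::]); rewrite cats0.
move: bal; rewrite lE => bal.
have Dp : deficit p <= theta (tau - a) * (size p)%:R.
  apply: Pn => [|| p' q' pE]; last 1 first.
  - by apply: (amin p' (q' ++ q)); rewrite lE pE catA.
  - by move: ltn; rewrite lE size_cat; lia.
  - exact: balanced_catl bal.
have Dq : deficit q <= e * (size q)%:R + f * \sum_(v <- q) v.
  apply: (IH q _ _ _ al M) => //.
  - by have := szp; rewrite ltr0n; move: ltk; rewrite lE size_cat; lia.
  - by move: ltn; rewrite lE size_cat; lia.
  - exact: balanced_catr bal.
  (* Appending a prefix of [q] to [p] cannot lower the average [a], so that prefix averages at least
     [a]. *)
  - move=> p' q' qE; have := amin (p ++ p') q'.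
    rewrite lE qE catA => /(_ erefl).
    rewrite big_cat /= size_cat natrD mulrDr pa lerD2l.
    by apply: le_trans; rewrite ler_wpM2r.
  - by move=> p' q' qE; apply: (hsuf (p ++ p')); rewrite lE qE catA.
rewrite deficit_cat size_cat natrD big_cat /= pa.
have := haff a; rewrite la aM => /(_ isT)/(ler_wpM2r (ltW szp)).
by move: Dp Dq; lra.
Qed.

Lemma deficit_boundP l : deficit_bound l.
Proof.
have [k] := ubnP (size l); elim: k l => // k IH l ltk bal m hpre.
have [->|l0] := eqVneq l [::]; first by rewrite /deficit big_nil mulr0.
have [p [q [a [lE p0 pa amin]]]] := ex_min_prefix l0.
have szp := natr_gt0_size p0; have szl := natr_gt0_size l0.
have ma : m <= a by rewrite -(ler_pM2r szp) -pa; exact: hpre lE.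
suff : deficit l <= theta (tau - a) * (size l)%:R.
  move/le_trans; apply; rewrite ler_pM2r // theta_homo //; lra.
(* If a proper prefix has minimal average, split there; otherwise
   [l = x :: xs] and [deficit xs] is bounded through the chord of [theta]
   over [[tau - a, tau - al]]. *)
have [q0|q0] := eqVneq q [::]; last first.
  move: bal; rewrite lE => bal; rewrite deficit_cat size_cat natrD mulrDr.
  apply: lerD; apply: IH.
  - by have := natr_gt0_size q0; rewrite ltr0n; move: ltk; rewrite lE size_cat; lia.
  - exact: balanced_catl bal.
  - by move=> p' q' pE; apply: (amin p' (q' ++ q)); rewrite lE pE catA.
  - by have := szp; rewrite ltr0n; move: ltk; rewrite lE size_cat; lia.
  - exact: balanced_catr bal.
  - move=> p' q' qE; have := amin (p ++ p') q'.
    rewrite lE qE catA => /(_ erefl).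
    by rewrite big_cat /= size_cat natrD mulrDr pa lerD2l.
move: lE; rewrite q0 cats0 => lE; move: pa szp; rewrite -lE => la _ {p q p0 q0 lE}.
case: l l0 ltk bal {hpre} amin la szl => // x xs _ ltk bal amin la _.
have ax : a <= x.
  by have := amin [:: x] xs erefl; rewrite big_seq1 mulr1.
move: la; rewrite big_cons /= -natr1 => la.
have IHn u : (size u <= size xs)%N -> deficit_bound u.
  by move=> h; apply: IH; exact: leq_ltn_trans h ltk.
rewrite [deficit _]big_cons -/(deficit xs).
have xbnd : Num.max (tau - x) 0 <= theta (tau - a).
  by apply: (le_trans (maxr0_le_theta _)); apply: theta_homo; lra.
have [xs0|xs0] := eqVneq xs [::].
  by rewrite xs0 /deficit big_nil addr0 add0r mulr1.
have [u [w [al [xsE u0 ua almin]]]] := ex_min_prefix xs0.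
have szu := natr_gt0_size u0; have szx := natr_gt0_size xs0.
have xal : x <= 1 + al.
  have := bal [::] x u w; rewrite xsE => /(_ erefl u0).
  by rewrite ua ler_pM2r //; lra.
have ala : al <= a.
  have := almin xs [::]; rewrite cats0 => /(_ erefl) h.
  by rewrite -(ler_pM2r szx); lra.
(* [x :: xs] averages [a] and its prefixes at least [a], so its suffixes average at most [a]. *)
have suf p q : xs = p ++ q -> \sum_(v <- q) v <= a * (size q)%:R.
  move=> E; have := amin (x :: p) q; rewrite E => /(_ erefl).
  move: la; rewrite E big_cons big_cat /= size_cat !natrD -natr1; lra.
have balx : balanced xs by exact: (@balanced_catr [:: x]).
have aff := deficit_affine_step IHn (leqnn _) balx almin suf.
have [aal|bpos] := leP a al.
  have := aff (theta (tau - a)) 0; rewrite mul0r addr0 => D.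
  have : deficit xs <= theta (tau - a) * (size xs)%:R.
    by apply: D => v /andP[h1 h2]; rewrite mul0r addr0 theta_homo //; lra.
  by lra.
set y := tau - a in xbnd *; set beta := a - al.
have b0 : 0 < beta by rewrite subr_gt0.
set kap := (theta (y + beta) - theta y) / beta.
have D : deficit xs <= (theta y + kap * a) * (size xs)%:R + - kap * \sum_(v <- xs) v.
  apply: aff => v /andP[h1 h2].
  have -> : tau - v = y + (a - v) by rewrite /y; ring.
  have := @theta_chord _ y (a - v) beta.
  rewrite -/kap => h; apply: (le_trans (h _ b0)); rewrite /beta; lra.
have kap_le1 : kap <= 1.
  rewrite ler_pdivrMr // mul1r; have := @theta_lip _ y (y + beta); lra.
have kap_ge0 : 0 <= kap.
  by rewrite divr_ge0 ?(ltW b0) // subr_ge0 theta_homo //; lra.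
(* For the case [x >= tau]: only [kap * (x - a)] remains there, and [x - a <= 1 - beta] by
   balance. *)
have kapb : kap * (1 - beta) <= theta y.
  have -> : kap * (1 - beta)
      = ((1 - beta) * theta (y + beta) - theta y + beta * theta y) / beta.
    by rewrite /kap; field; rewrite gt_eqF.
  rewrite ler_pdivrMr //; have := theta_shift y (ltW b0); lra.
suff : Num.max (tau - x) 0 + kap * (x - a) <= theta y.
  have : (theta y + kap * a) * (size xs)%:R + - kap * \sum_(v <- xs) v
       = theta y * (size xs)%:R + kap * (x - a).
    have -> : \sum_(v <- xs) v = a * ((size xs)%:R + 1) - x by lra.
    ring.
  by lra.
have [h|h] := leP (tau - x) 0.
  rewrite add0r; apply: le_trans kapb; rewrite ler_wpM2l //.
  by rewrite /beta; lra.
(* Here [kap <= 1] and [a <= x] bound the left side by [tau - a]. *)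
apply: le_trans (theta_ge y); rewrite /y; nra.
Qed.
End Averages.

(* [deficit_boundP] at the optimal [tau = m + 1 - ln (d / #|I|)]. *)
Lemma balanced_subset_sum (R : realType) (d : nat) (x : 'I_d -> R) (I : {set 'I_d}) m :
  balanced [seq x i | i <- enum 'I_d] ->
  (forall p q, [seq x i | i <- enum 'I_d] = p ++ q ->
     m * (size p)%:R <= \sum_(v <- p) v) ->
  I != set0 ->
  \sum_(i in I) (m - x i) <= #|I|%:R * ln (d%:R / #|I|%:R).
Proof.
move=> bal hpre I0.
have k0 : 0 < #|I|%:R :> R by rewrite ltr0n card_gt0.
have kd : #|I|%:R <= d%:R :> R by rewrite ler_nat -[d in (_ <= d)%N]card_ord max_card.
have d0 := lt_le_trans k0 kd.
set lk := ln _.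
have lkE : ln (#|I|%:R / d%:R) = - lk.
  by rewrite -lnV ?invf_div // posrE divr_gt0.
have lk0 : 0 <= lk by apply: ln_ge0; rewrite ler_pdivlMr ?mul1r.
have := deficit_boundP (m + 1 - lk) bal hpre.
rewrite size_map size_enum_ord /theta.
have -> : m + 1 - lk - m = 1 - lk by ring.
rewrite ifT; last by lra.
have -> : 1 - lk - 1 = ln (#|I|%:R / d%:R) by rewrite lkE; ring.
rewrite lnK ?posrE ?divr_gt0 // divfK ?gt_eqF // => h.
suff : \sum_(i in I) (m + 1 - lk - x i) <= #|I|%:R.
  have -> : \sum_(i in I) (m + 1 - lk - x i)
     = \sum_(i in I) (m - x i) + #|I|%:R * (1 - lk).
    rewrite mulr_natl -sumr_const -big_split /=.
    by apply: eq_bigr => i _; ring.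
  lra.
apply: le_trans h; rewrite /deficit big_map big_enum /= big_mkcond /=.
by apply: ler_sum => i _; case: ifP => _; rewrite le_max lexx ?orbT.
Qed.

(** * Short combinations by the pigeonhole principle *)

Lemma pigeonhole3 (T U : finType) (g : T -> U) : (2 * #|U| < #|T|)%N ->
  exists x y z, [/\ x != y, y != z & z != x] /\ (g x = g y /\ g y = g z).
Proof.
move=> lt; suff [u] : exists u, (2 < #|[pred x | g x == u]|)%N.
  move=> /card_gt2P [x [y [z [[/eqP xu /eqP yu /eqP zu] xyz]]]].
  by exists x, y, z; rewrite xu yu zu.
apply: contrapT => H; move: lt; rewrite ltnNge => /negP; apply.
rewrite -sum1_card (partition_big g predT) //= mulnC.
rewrite -sum_nat_const; apply: leq_sum => u _; rewrite sum1_card leqNgt.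
by apply/negP => h; apply: H; exists u.
Qed.

Section ShortCombination.
Variable R : realType.

(** The slack [e] will absorb the rounding of box sides to whole numbers of cells. *)
Lemma prod_perturb (n : nat) (t : nat -> R) (B : R) :
  (forall i, 0 < t i) -> \prod_(i < n) t i < B ->
  exists2 e, 0 < e & \prod_(i < n) (t i + e) < B.
Proof.
move=> t0; elim: n B => [|n IH] B.
  by rewrite big_ord0 => h; exists 1 => //; rewrite big_ord0.
rewrite big_ord_recr /= => h.
have P0 : 0 < \prod_(i < n) t i by apply: prodr_gt0.
set P := \prod_(i < n) t i in h P0 IH.
have tn := t0 n.
have PB : P < B / t n by rewrite ltr_pdivlMr.
pose B' := (P + B / t n) / 2.
have B'P : P < B' by rewrite /B'; lra.
have B'B : B' * t n < B by rewrite -ltr_pdivlMr // /B'; lra.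
have [e e0 he] := IH _ B'P.
have B'0 : 0 < B' by lra.
pose e2 := Num.min e ((B - B' * t n) / B').
have e20 : 0 < e2 by rewrite lt_min e0 divr_gt0 // subr_gt0.
exists e2 => //; rewrite big_ord_recr /=.
have h1 : \prod_(i < n) (t i + e2) < B'.
  apply: le_lt_trans he; apply: ler_prod => i _.
  by rewrite lerD2l ge_min lexx (ltW (addr_gt0 (t0 i) e20)).
have h2 : B' * (t n + e2) <= B.
  have : e2 <= (B - B' * t n) / B' by rewrite ge_min lexx orbT.
  rewrite ler_pdivlMr //; lra.
by apply: lt_le_trans h2; rewrite ltr_pM2r // addr_gt0.
Qed.

Variables (m : nat) (mu : nat -> nat -> R).

(* The [i]-th coordinate of [\sum_j z j *: b j] on the Gram--Schmidt basis. *)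
Definition gs_coord (z : nat -> int) (i : nat) : R :=
  (z i)%:~R + \sum_(i.+1 <= j < m) (z j)%:~R * mu j i.

Lemma gs_coordB z z' i :
  gs_coord (fun j => z j - z' j) i = gs_coord z i - gs_coord z' i.
Proof.
rewrite /gs_coord opprD addrACA -sumrB intrB; congr (_ + _).
by apply: eq_bigr => j _; rewrite intrB mulrBl.
Qed.

(** [gs_coord z i] involves only [z j] with [j >= i], so the entries are fixed from the last to the
    first, each by one floor. *)
Lemma ex_gs_coord_floor (a : nat -> int) : exists z, forall i, (i < m)%N ->
  (a i)%:~R <= gs_coord z i < (a i)%:~R + 1.
Proof.
suff H k : (k <= m)%N -> exists z, forall i, (m - k <= i < m)%N ->
    (a i)%:~R <= gs_coord z i < (a i)%:~R + 1.
  have [z hz] := H m (leqnn m).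
  by exists z => i im; apply: hz; rewrite subnn.
elim: k => [|k IH] km.
  by exists (fun=> 0) => i /andP[]; rewrite subn0; lia.
have [z hz] := IH (ltnW km).
pose i0 := (m - k.+1)%N.
pose s := \sum_(i0.+1 <= j < m) (z j)%:~R * mu j i0.
exists (fun j => if j == i0 then a i0 - Num.floor s else z j) => i /andP[i0i im].
rewrite /gs_coord; have -> :
   \sum_(i.+1 <= j < m) (if j == i0 then a i0 - Num.floor s else z j)%:~R * mu j i
   = \sum_(i.+1 <= j < m) (z j)%:~R * mu j i.
  apply: eq_big_nat => j /andP[ij jm]; case: eqP => // ji; move: i0i; lia.
case: eqP => [->|ne].
  rewrite -/s intrB; have := floor_itv s; rewrite intrD; lra.
by apply: hz; rewrite im andbT; move: i0i ne; rewrite /i0; lia.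
Qed.

(** In sorted order the two inner gaps add up to the outer one, so the sum is at most twice the
    square of the outer gap. *)
Lemma three_in_unit_interval (q u v w : R) :
  q <= u < q + 1 -> q <= v < q + 1 -> q <= w < q + 1 ->
  (u - v) ^+ 2 + (v - w) ^+ 2 + (w - u) ^+ 2 < 2.
Proof.
move=> /andP[u0 u1] /andP[v0 v1] /andP[w0 w1].
have key (x y z : R) : x <= y -> y <= z -> z - x < 1 ->
    (x - y) ^+ 2 + (y - z) ^+ 2 + (z - x) ^+ 2 < 2.
  by move=> xy yz zx; nra.
have [uv|/ltW uv] := leP u v; have [vw|/ltW vw] := leP v w;
  have [uw|/ltW uw] := leP u w.
- have := key u v w uv vw; lra.
- have := key u v w uv vw; lra.
- have := key u w v uw vw; lra.
- have := key w u v uw uv; lra.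
- have := key v u w uv uw; lra.
- have := key v w u vw uw; lra.
- have := key w v u vw uv; lra.
- have := key w v u vw uv; lra.
Qed.

(* Three lattice points in a common half-open cube of side [c]; the closest
   two of them are at squared distance less than [2 m c^2 / 3]. *)
Lemma ex_short_combination (r : nat -> R) (c : R) :
  (0 < m)%N -> (forall i, 0 < r i) -> 0 < c ->
  2 * \prod_(i < m) r i < c ^+ m ->
  exists2 z, exists2 i, (i < m)%N & gs_coord z i != 0 &
    3 * \sum_(i < m) (gs_coord z i * r i) ^+ 2 < 2 * m%:R * c ^+ 2.
Proof.
move=> m0 r0 c0 hc.
pose t i := r i / c.
have t0 i : 0 < t i by exact: divr_gt0.
have ht : \prod_(i < m) t i < 2^-1.
  rewrite prodf_div prodr_const card_ord ltr_pdivrMr ?exprn_gt0 //; lra.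
have [e e0 he] := prod_perturb t0 ht.
(* Each of [N ^ m] unit cells will supply a lattice point; after scaling by [t], [(K i).+1] unit
   intervals on axis [i] cover them all. As [N > e^-1], rounding up costs at most the slack [e]. *)
pose N := Num.bound e^-1.
have Ne : e^-1 < N%:R by apply: archi_boundP; rewrite invr_ge0 ltW.
have N0 : 0 < N%:R :> R by apply: lt_trans Ne; rewrite invr_gt0.
pose K i := Num.truncn (N%:R * t i).
have KN i : (K i).+1%:R <= N%:R * (t i + e).
  have : (K i)%:R <= N%:R * t i by rewrite truncn_le // mulr_ge0 // ltW.
  have : 1 <= N%:R * e by rewrite -ler_pdivrMr // mul1r ltW.
  rewrite -natr1; lra.
have cardlt : (2 * #|{dffun forall i : 'I_m, 'I_(K i).+1}| < #|{ffun 'I_m -> 'I_N}|)%N.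
  rewrite card_ffun !card_ord card_dep_ffun foldrE big_map big_enum /=.
  under eq_bigr do rewrite card_ord.
  rewrite -(ltr_nat R) natrM natrX natr_prod.
  apply: le_lt_trans (_ : 2 * (N%:R ^+ m * \prod_(i < m) (t i + e)) < _).
    rewrite ler_pM2l //.
    have -> : N%:R ^+ m * \prod_(i < m) (t i + e) = \prod_(i < m) (N%:R * (t i + e)).
      by rewrite big_split /= prodr_const card_ord.
    by apply: ler_prod => i _; rewrite ler0n KN.
  have := exprn_gt0 m N0; nra.
have [f hf] : {f : {ffun 'I_m -> 'I_N} -> nat -> int &
    forall (a : {ffun 'I_m -> 'I_N}) (i : 'I_m),
    (a i)%:R <= gs_coord (f a) i < (a i)%:R + 1}.
  apply: (@choice _ _ (fun (a : {ffun 'I_m -> 'I_N}) z =>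
    forall i : 'I_m, (a i)%:R <= gs_coord z i < (a i)%:R + 1)).
  move=> a.
  have [z hz] := ex_gs_coord_floor
    (fun i => if insub i is Some j then (a j : nat)%:Z else 0).
  by exists z => i; have := hz i (ltn_ord i); rewrite valK.
pose Y a i := gs_coord (f a) i * t i.
have Y0 a (i : 'I_m) : 0 <= Y a i.
  have /andP[h _] := hf a i; rewrite mulr_ge0 ?(ltW (t0 i)) //.
  by apply: le_trans h; rewrite ler0n.
have YK a (i : 'I_m) : (Num.truncn (Y a i) <= K i)%N.
  apply: le_truncn; rewrite ler_pM2r //.
  have /andP[_ /ltW h] := hf a i; apply: le_trans h _.
  by rewrite natr1 ler_nat.
pose g a : {dffun forall i : 'I_m, 'I_(K i).+1} :=
  [ffun i : 'I_m => inord (Num.truncn (Y a i)) : 'I_(K i).+1].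
have gE a b : g a = g b -> forall i : 'I_m, Num.truncn (Y a i) = Num.truncn (Y b i).
  move=> /ffunP gab i; have := congr1 val (gab i).
  by rewrite !ffunE /= !inordK ?ltnS ?YK.
have [a1 [a2 [a3 [[n12 n23 n31] [/gE g12 /gE g23]]]]] := pigeonhole3 g cardlt.
(* Equal Gram-Schmidt coordinates would put both points in the same half-open cell. *)
have neq a b : a != b -> exists2 i, (i < m)%N & gs_coord (fun j => f a j - f b j) i != 0.
  move=> /eqP ab; apply: contrapT => H; apply: ab; apply/ffunP => i.
  have /eqP : gs_coord (fun j => f a j - f b j) i == 0.
    by apply/negP => /negP h; apply: H; exists i.
  rewrite gs_coordB => h; apply: val_inj => /=.
  have := hf a i; have := hf b i => /andP[b1 b2] /andP[a1' a2'].
  have : (a i)%:R < (b i)%:R + 1 :> R by lra.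
  have : (b i)%:R < (a i)%:R + 1 :> R by lra.
  rewrite !natr1 !ltr_nat !ltnS => ba ab'.
  by apply/eqP; rewrite eqn_leq ab' ba.
pose D a b := \sum_(i < m) (Y a i - Y b i) ^+ 2.
have sumD : D a1 a2 + D a2 a3 + D a3 a1 < 2 * m%:R.
  rewrite /D -!big_split /= mulr_natr -[m in X in _ < X]card_ord -sumr_const.
  apply: ltr_sum; first by apply/hasP; exists (Ordinal m0); rewrite ?mem_index_enum.
  move=> i _.
  have tr a : (Num.truncn (Y a i))%:R <= Y a i < (Num.truncn (Y a i))%:R + 1.
    by rewrite natr1; exact: truncn_itv.
  have := three_in_unit_interval (tr a1); rewrite g12 => /(_ _ _ (tr a2)).
  by rewrite g23 => /(_ _ (tr a3)).
have fin a b : a != b -> 3 * D a b < 2 * m%:R ->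
    exists2 z, exists2 i, (i < m)%N & gs_coord z i != 0 &
    3 * \sum_(i < m) (gs_coord z i * r i) ^+ 2 < 2 * m%:R * c ^+ 2.
  move=> ab h; exists (fun j => f a j - f b j); first exact: neq.
  have -> : \sum_(i < m) (gs_coord (fun j => f a j - f b j) i * r i) ^+ 2
     = D a b * c ^+ 2.
    rewrite mulr_suml; apply: eq_bigr => i _; rewrite gs_coordB /Y /t.
    by field; rewrite gt_eqF.
  by rewrite mulrA ltr_pM2r // exprn_gt0.
have [h|h12] := ltP (3 * D a1 a2) (2 * m%:R); first exact: fin h.
have [h|h23] := ltP (3 * D a2 a3) (2 * m%:R); first exact: fin h.
by apply: fin n31 _; lra.
Qed.

(** At [k = 9] this is 36 against about 38.4; it fails at [k = 8], hence the split between ranks 8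
    and 9. *)
Lemma four_mul_le_three_half_exp (k : nat) : (9 <= k)%N ->
  4 * k%:R <= (3 / 2) ^+ k :> R.
Proof.
move=> /subnK <-; elim: (k - 9)%N => [|j IH]; first by rewrite add0n; lra.
rewrite addSn exprS; move: IH; rewrite -natr1 natrD.
have : 0 <= j%:R :> R by []. 
lra.
Qed.

Lemma hermite_bound_large (S : nat -> R) : (9 <= m)%N -> (forall i, 0 < S i) ->
  (forall z i, (i < m)%N -> gs_coord z i != 0 ->
     S 0%N <= \sum_(i < m) gs_coord z i ^+ 2 * S i) ->
  S 0%N ^+ m <= m%:R ^+ m.-1 * \prod_(i < m) S i.
Proof.
move=> m9 S0 hS; rewrite leNgt; apply/negP => hlt.
have m0 : (0 < m)%N by lia.
have m0' : 0 < m%:R :> R by rewrite ltr0n.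
(* With this side, [2 / 3 * m * c ^ 2] is exactly [S 0]. *)
pose c := Num.sqrt (3 * S 0%N / (2 * m%:R)).
have arg0 : 0 < 3 * S 0%N / (2 * m%:R) by rewrite divr_gt0 ?mulr_gt0.
have c0 : 0 < c by rewrite sqrtr_gt0.
have cE : c ^+ 2 = 3 * S 0%N / (2 * m%:R) by rewrite sqr_sqrtr // ltW.
pose r i := Num.sqrt (S i).
have r0 i : 0 < r i by rewrite sqrtr_gt0.
have rE i : r i ^+ 2 = S i by rewrite sqr_sqrtr // ltW.
have P0 : 0 < \prod_(i < m) S i by apply: prodr_gt0.
(* Squared, and with the negated bound put in, this reduces to [4 * m <= (3 / 2) ^ m]. *)
have vol : 2 * \prod_(i < m) r i < c ^+ m.
  rewrite -(@ltr_pXn2r _ 2) ?nnegrE ?exprn_ge0 ?(ltW c0) //; last first.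
    by rewrite mulr_ge0 // prodr_ge0 // => i _; exact: ltW.
  rewrite exprMn -prodrXl -exprM mulnC exprM cE.
  under eq_bigr do rewrite rE.
  have -> : (3 * S 0%N / (2 * m%:R)) ^+ m
      = (3 / 2) ^+ m * (S 0%N ^+ m) / (m%:R * m%:R ^+ m.-1).
    rewrite -exprS prednK //.
    have -> : 3 * S 0%N / (2 * m%:R) = (3/2) * S 0%N / m%:R by field; rewrite gt_eqF.
    by rewrite expr_div_n exprMn.
  rewrite ltr_pdivlMr ?mulr_gt0 ?exprn_gt0 //.
  have h4 := four_mul_le_three_half_exp m9.
  apply: le_lt_trans (_ : (3 / 2) ^+ m * (m%:R ^+ m.-1 * \prod_(i < m) S i) < _).
    rewrite (_ : _ * _ * _ = 4 * m%:R * (m%:R ^+ m.-1 * \prod_(i < m) S i)); last by ring.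
    by rewrite ler_pM2r // mulr_gt0 // exprn_gt0.
  by rewrite ltr_pM2l // exprn_gt0 //; lra.
have [z [i im zi]] := ex_short_combination m0 r0 c0 vol.
have -> : \sum_(i < m) (gs_coord z i * r i) ^+ 2 = \sum_(i < m) gs_coord z i ^+ 2 * S i.
  by apply: eq_bigr => j _; rewrite exprMn rE.
have := hS z i im zi; set T := \sum_(i < m) _ => ST.
rewrite cE; have -> : 2 * m%:R * (3 * S 0%N / (2 * m%:R)) = 3 * S 0%N by field; rewrite gt_eqF.
lra.
Qed.

End ShortCombination.

(** * Gram-Schmidt vectors of HKZ-reduced bases *)

Section GramSchmidt.
Variables (R : realType) (n : nat).
Local Notation vec := 'rV[R]_n.
Implicit Types (u v w : vec) (b : nat -> vec).

Lemma dotvC u v : dotv u v = dotv v u.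
Proof. by apply: eq_bigr => k _; rewrite mulrC. Qed.

Lemma dotvDl u v w : dotv (u + v) w = dotv u w + dotv v w.
Proof. by rewrite -big_split; apply: eq_bigr => k _; rewrite mxE mulrDl. Qed.

Lemma dotvZl a u v : dotv (a *: u) v = a * dotv u v.
Proof. by rewrite mulr_sumr; apply: eq_bigr => k _; rewrite mxE mulrA. Qed.

Lemma dotv0l v : dotv 0 v = 0.
Proof. by rewrite -[0](scale0r v) dotvZl mul0r. Qed.

Lemma dotv0r v : dotv v 0 = 0.
Proof. by rewrite dotvC dotv0l. Qed.

Lemma dotvBl u v w : dotv (u - v) w = dotv u w - dotv v w.
Proof. by rewrite dotvDl -scaleN1r dotvZl mulN1r. Qed.

Lemma dotv_suml I (r : seq I) (P : pred I) (F : I -> vec) v :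
  dotv (\sum_(i <- r | P i) F i) v = \sum_(i <- r | P i) dotv (F i) v.
Proof.
by apply: (big_morph (fun u => dotv u v) (fun _ _ => dotvDl _ _ _)); exact: dotv0l.
Qed.

Lemma dotv_ge0 v : 0 <= dotv v v.
Proof. by apply: sumr_ge0 => k _; rewrite -expr2 sqr_ge0. Qed.

Lemma dotv_eq0 v : (dotv v v == 0) = (v == 0).
Proof.
apply/eqP/eqP => [h|->]; last exact: dotv0l.
apply/rowP => k; rewrite mxE; apply/eqP.
rewrite -sqrf_eq0 expr2; apply/eqP.
by apply: (psumr_eq0P _ h) => // i _; rewrite -expr2 sqr_ge0.
Qed.

Lemma size_gs_list b k : size (gs_list b k) = k.
Proof. by elim: k => //= k IH; rewrite size_rcons IH. Qed.

Lemma nth_gs_list b k i : (i < k)%N -> nth 0 (gs_list b k) i = gs b i.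
Proof.
elim: k => // k IH; rewrite ltnS leq_eqVlt => /predU1P[->//|ik].
by rewrite /= nth_rcons size_gs_list ik IH.
Qed.

Lemma gsE b i : gs b i = b i - \sum_(j < i) mu b i j *: gs b j.
Proof.
rewrite /gs /= nth_rcons size_gs_list ltnn eqxx; congr (_ - _).
rewrite (big_nth 0) size_gs_list big_mkord; apply: eq_bigr => j _.
by rewrite nth_gs_list.
Qed.

Lemma basis_gsE b i : b i = gs b i + \sum_(j < i) mu b i j *: gs b j.
Proof. by rewrite gsE subrK. Qed.

Lemma gs0 b : gs b 0 = b 0%N.
Proof. by rewrite gsE big_ord0 subr0. Qed.

Lemma mu_dotv b i j : mu b i j * dotv (gs b j) (gs b j) = dotv (b i) (gs b j).
Proof.
rewrite /mu; have [/eqP|h] := eqVneq (dotv (gs b j) (gs b j)) 0.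
  by rewrite dotv_eq0 => /eqP ->; rewrite !dotv0r mulr0.
by rewrite divfK.
Qed.

Lemma gs_orthogonal b i j : i != j -> dotv (gs b i) (gs b j) = 0.
Proof.
suff H i' j' : (j' < i')%N -> dotv (gs b i') (gs b j') = 0.
  by rewrite neq_ltn => /orP[ij|]; [rewrite dotvC; exact: H | exact: H].
move: i' j' => {}i {}j; have [k] := ubnP i; elim: k i j => // k IH i j ik ji.
rewrite {1}gsE dotvBl dotv_suml (bigD1 (Ordinal ji)) //= dotvZl mu_dotv.
rewrite big1 => [|l lj]; first by rewrite addr0 subrr.
rewrite dotvZl.
have {}lj : (l : nat) != j by apply: contraNneq lj => lj; apply/eqP/val_inj.
have [jl|lj'] := ltnP j l; first by rewrite IH ?mulr0 //; have := ltn_ord l; lia.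
by rewrite dotvC IH ?mulr0 //; lia.
Qed.

(** Removing the [b 0] component changes no inner product with later Gram-Schmidt vectors. This
    carries results on initial blocks to every start [s] along the recursion of [HKZ]. *)
Lemma gs_proj_orth b i :
  gs (fun i => proj_orth (b 0%N) (b i.+1)) i = gs b i.+1.
Proof.
set b' := fun i => _; have [k] := ubnP i; elim: k i => // k IH i ik.
rewrite gsE [RHS]gsE big_ord_recl /= opprD addrA gs0 /mu gs0; congr (_ - _).
apply: eq_bigr => j _.
have jk : (j < k)%N by have := ltn_ord j; lia.
rewrite /mu IH // /bump /= add1n /b' /proj_orth dotvBl dotvZl.
by rewrite -(gs0 b) (@gs_orthogonal b 0 j.+1) // mulr0 subr0.
Qed.

(** The first [d] vectors of [b] lie in the span of as many [gs b j]; this span has rank [d], so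
    none of them vanishes. *)
Lemma lin_indep_gs_neq0 b d i : lin_indep d b -> (i < d)%N -> gs b i != 0.
Proof.
move=> free id; apply/eqP => gi0.
pose G := \matrix_(i < d) gs b i.
have sub : (\matrix_(i < d, k < n) b i 0 k <= G)%MS.
  have gsG j : (j < d)%N -> (gs b j <= G)%MS.
    by move=> jd; rewrite (_ : gs b j = row (Ordinal jd) G) ?row_sub // rowK.
  apply/row_subP => j; rewrite (_ : row j _ = b j); last first.
    by apply/rowP => k; rewrite !mxE.
  rewrite basis_gsE addmx_sub ?gsG // summx_sub // => k _.
  by rewrite scalemx_sub ?gsG // (ltn_trans (ltn_ord k)).
have rG : row_free G.
  rewrite /row_free eqn_leq rank_leq_row /=.
  by have := mxrankS sub; rewrite (eqP free).
have : delta_mx 0 (Ordinal id) *m G = (0 : 'rV_d) *m G.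
  by rewrite -rowE rowK mul0mx gi0.
move/(row_free_inj rG)/matrixP/(_ 0 (Ordinal id)).
by rewrite !mxE !eqxx => /eqP; rewrite oner_eq0.
Qed.

Lemma combination_gs b m (z : nat -> int) :
  \sum_(i < m) (z i)%:~R *: b i = \sum_(i < m) gs_coord m (mu b) z i *: gs b i.
Proof.

under eq_bigr => i _ do rewrite basis_gsE scalerDr scaler_sumr.
under [RHS]eq_bigr => i _ do rewrite scalerDl scaler_suml big_geq_mkord.
rewrite !big_split /=; congr (_ + _).
under eq_bigr => i _ do rewrite (big_ord_widen m
  (fun j => (z i)%:~R *: (mu b i j *: gs b j)) (ltnW (ltn_ord i))).
rewrite (exchange_big_dep predT) //=; apply: eq_bigr => i _.
by apply: eq_bigr => j _; rewrite scalerA.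
Qed.

Lemma dotv_combination_gs b m (c : nat -> R) :
  let v := \sum_(i < m) c i *: gs b i in
  dotv v v = \sum_(i < m) c i ^+ 2 * dotv (gs b i) (gs b i).
Proof.
rewrite /= dotv_suml; apply: eq_bigr => i _.
rewrite dotvZl dotvC dotv_suml (bigD1 i) //= big1 => [|j ji].
  by rewrite addr0 dotvZl mulrA.
by rewrite dotvZl gs_orthogonal ?mulr0.
Qed.

(** Coefficients are padded with zeros beyond [m]; a nonzero Gram-Schmidt coordinate makes the
    combination nonzero. *)
Lemma first_shortest_gs b d m z i :
  first_shortest d b -> (m <= d)%N -> (forall i, (i < d)%N -> gs b i != 0) ->
  (i < m)%N -> gs_coord m (mu b) z i != 0 ->
  dotv (gs b 0) (gs b 0)
    <= \sum_(i < m) gs_coord m (mu b) z i ^+ 2 * dotv (gs b i) (gs b i).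
Proof.
move=> [_ short] md gsn0 im zi.
pose z' (j : 'I_d) := if (j < m)%N then z j else 0.
have vE : lat_comb b z' = \sum_(i < m) gs_coord m (mu b) z i *: gs b i.
  rewrite -combination_gs /lat_comb (big_ord_widen d (fun i => (z i)%:~R *: b i)) //.
  rewrite [RHS]big_mkcond; apply: eq_bigr => j _; rewrite /z'.
  by case: ifP => // _; rewrite scale0r.
rewrite gs0 -dotv_combination_gs -vE.
suff nz : lat_comb b z' != 0.
  by have := short z' nz; rewrite /normv ler_sqrt ?dotv_ge0.
rewrite -dotv_eq0 vE dotv_combination_gs gt_eqF //.
rewrite (bigD1 (Ordinal im)) //= ltr_pwDl //.
  rewrite mulr_gt0 ?exprn_even_gt0 // lt_neqAle dotv_ge0 eq_sym dotv_eq0.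
  by rewrite gsn0 // (leq_trans im).
by apply: sumr_ge0 => j _; rewrite mulr_ge0 ?sqr_ge0 ?dotv_ge0.
Qed.

End GramSchmidt.

(** * Lattice inequality for the blocks of an HKZ-reduced basis *)

Section HKZ.
Variables (R : realType) (n : nat).
Implicit Types b : nat -> 'rV[R]_n.
Local Notation nsq b i := (dotv (gs b i) (gs b i)).

(** Minimality of [b 0] against [b 1], whose coefficient along [b 0] is at most 1/2 in absolute
    value. *)
Lemma hermite_step b d : (2 <= d)%N -> size_reduced d b -> first_shortest d b ->
  (forall i, (i < d)%N -> gs b i != 0) ->
  nsq b 0 <= 4 / 3 * nsq b 1.
Proof.
move=> d2 sr fs gsn0.
have := @first_shortest_gs R n b d 2 (fun j => (j == 1%N)%:R) 1 fs d2 gsn0 isT.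
rewrite /gs_coord !big_ord_recr big_ord0 /= add0r.
rewrite big_nat1 big_geq // !mul1r addr0 add0r expr1n mul1r => /(_ (oner_neq0 _)).
have := sr 1%N 0%N; rewrite d2 => /(_ isT); rewrite ler_norml => /andP[mu1 mu2].
have : mu b 1 0 ^+ 2 <= 1 / 4 by nra.
by have := dotv_ge0 (gs b 0); nra.
Qed.

Lemma HKZ_hermite b d s : HKZ d b -> (forall i, (i < d)%N -> gs b i != 0) ->
  (s.+1 < d)%N -> nsq b s <= 4 / 3 * nsq b s.+1.
Proof.
elim: s d b => [|s IH] [//|d] b [sr fs hkz] gsn0 sd; first exact: hermite_step gsn0.
have := IH d _ hkz; rewrite !gs_proj_orth; apply=> // i id.
by rewrite gs_proj_orth gsn0.
Qed.

(** The last case is about 7.49 against 8; at [i = 8] the inequality fails. *)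
Lemma four_thirds_exp_le i : (i <= 7)%N -> (4 / 3) ^+ i <= i.+1%:R :> R.
Proof. by move: i; do 8 (case=> [_|]; first by lra). Qed.

(* Slightly stronger than Minkowski's bound with Hermite's constant at most
   [m], which would read [m ^ m] and would not suffice for the theorem.  Up to
   [m = 8] it follows from Hermite's step, and from [m = 9] on by pigeonhole. *)
Lemma HKZ_minkowski b d s m : HKZ d b -> (forall i, (i < d)%N -> gs b i != 0) ->
  (s + m <= d)%N -> (0 < m)%N ->
  nsq b s ^+ m <= m%:R ^+ m.-1 * \prod_(i < m) nsq b (s + i).
Proof.
elim: s d b => [|s IH] d b; last first.
  case: d => [//|d] [_ _ hkz] gsn0 smd m0.
  have := IH d _ hkz; rewrite !gs_proj_orth.
  under eq_bigr do rewrite gs_proj_orth -addSn.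
  apply=> // i id.
  by rewrite gs_proj_orth gsn0.
move=> hkz gsn0; rewrite add0n => md m0; under eq_bigr do rewrite add0n.
have S0 i : (i < d)%N -> 0 < nsq b i.
  by move=> id; rewrite lt_neqAle dotv_ge0 eq_sym dotv_eq0 gsn0.
have [m8|m9] := leqP m 8.
  have chain i : (i < m)%N -> nsq b 0 <= (4 / 3) ^+ i * nsq b i.
    elim: i => [|i IHi] im; first by rewrite expr0 mul1r.
    apply: le_trans (IHi (ltnW im)) _.
    rewrite exprSr -mulrA ler_wpM2l ?exprn_ge0 //; first by lra.
    by apply: HKZ_hermite hkz gsn0 _; lia.
  case: m m0 md m8 chain => // m _ md m8 chain.
  (* One factor [nsq b 0] cancels; each other one is at most [(4 / 3) ^ i * nsq b i], and
     [(4 / 3) ^ i <= i.+1] is at most the rank. *)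
  rewrite exprS big_ord_recl mulrCA ler_pM2l ?S0 //=; last by lia.
  rewrite -[m in X in X * _]card_ord -prodr_const -big_split /=.
  rewrite -[m in _ ^+ m]card_ord -prodr_const; apply: ler_prod => i _.
  rewrite dotv_ge0 /= (le_trans (chain _ (ltn_ord (lift ord0 i)))) //.
  rewrite ler_wpM2r ?dotv_ge0 //.
  apply: (le_trans (four_thirds_exp_le _)); first by have := ltn_ord (lift ord0 i); lia.
  by rewrite ler_nat card_ord (ltn_ord (lift ord0 i)).
(* Padding with 1 makes [S] positive at every index. *)
pose S i := if (i < d)%N then nsq b i else 1.
have SE i : (i < m)%N -> S i = nsq b i by move=> im; rewrite /S (leq_trans im).
have fs : first_shortest d b by case: d hkz {S SE gsn0 S0} md => [|d]; [lia | case].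
have -> : \prod_(i < m) nsq b i = \prod_(i < m) S i.
  by apply: eq_bigr => i _; rewrite SE.
rewrite -SE //; apply: (@hermite_bound_large R m (mu b) S m9) => [i|z i im zi].
  by rewrite /S; case: ifP => // /S0.
rewrite SE //.
under eq_bigr => j _ do rewrite SE //.
exact: first_shortest_gs fs md gsn0 im zi.
Qed.

End HKZ.

Lemma ln_prod (R : realType) (J : finType) (P : pred J) (F : J -> R) :
  (forall i, P i -> 0 < F i) ->
  ln (\prod_(i | P i) F i) = \sum_(i | P i) ln (F i).
Proof.
move=> F0; suff [] : 0 < \prod_(i | P i) F i /\
  ln (\prod_(i | P i) F i) = \sum_(i | P i) ln (F i) by [].
apply: (big_ind2 (fun x y => 0 < x /\ ln x = y)) => [|x x' y y' [x0 <-] [y0 <-]|i Pi].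
- by rewrite ltr01 ln1.
- by rewrite mulr_gt0 // lnM.
- by rewrite F0.
Qed.

(** * Logarithmic profile of an HKZ-reduced basis *)

Section HKZProfile.
Variables (R : realType) (n d : nat) (b : nat -> 'rV[R]_n).
Hypotheses (d2 : (2 <= d)%N) (hkz : HKZ d b).
Hypothesis gsn0 : forall i, (i < d)%N -> gs b i != 0.

(* Since [dotv] is the squared norm, this is [log ||b_i^*|| / log (sqrt d)]. *)
Definition profile (i : nat) : R := ln (dotv (gs b i) (gs b i)) / ln d%:R.

Lemma lnd_gt0 : 0 < ln d%:R :> R.
Proof. by rewrite ln_gt0 // ltr1n. Qed.

(** Logarithm of the bound for the block of rank [k.+1]: one [ln] of the first vector cancels, and
    the factor [k.+1 ^ k] contributes at most [k * ln d]. *)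
Lemma profile_step s k : (0 < k)%N -> (s + k < d)%N ->
  (profile s - 1) * k%:R <= \sum_(i < k) profile (s + i.+1).
Proof.
move=> k0 skd; have L0 := lnd_gt0.
have S0 i : (i < d)%N -> 0 < dotv (gs b i) (gs b i).
  by move=> id; rewrite lt_neqAle dotv_ge0 eq_sym dotv_eq0 gsn0.
have := @HKZ_minkowski R n b d s k.+1 hkz gsn0.
rewrite addnS => /(_ skd isT).
have idx (i : 'I_k.+1) : (s + i < d)%N by have := ltn_ord i; lia.
have P0 : 0 < \prod_(i < k.+1) dotv (gs b (s + i)) (gs b (s + i)).
  by apply: prodr_gt0 => i _; apply: S0.
have Ss : 0 < dotv (gs b s) (gs b s) by apply: S0; lia.
have kk0 : 0 < k.+1%:R ^+ k :> R by rewrite exprn_gt0 // ltr0n.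
rewrite /= -ler_ln ?posrE ?exprn_gt0 // ?mulr_gt0 //.
rewrite lnM ?posrE // !lnXn ?ltr0n // ln_prod; last by move=> i _; exact: S0.
rewrite big_ord_recl /= addn0 mulrSr => h.
have lk : ln k.+1%:R <= ln d%:R :> R.
  by rewrite ler_ln ?posrE ?ltr0n // ?ler_nat; lia.
rewrite /profile -mulr_suml ler_pdivlMr //.
rewrite (_ : (_ - 1) * _ * _ = ln (dotv (gs b s) (gs b s)) * k%:R - ln d%:R * k%:R);
  last by field; rewrite gt_eqF.
rewrite -[_ *+ k](mulr_natr (ln (dotv _ _))) -[ln k.+1%:R *+ k]mulr_natr in h.
have : ln k.+1%:R * k%:R <= ln d%:R * k%:R :> R by rewrite ler_wpM2r.
move: h; under eq_bigr do rewrite /bump leq0n add1n.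
lra.
Qed.

Lemma profile_balanced : balanced [seq profile i | i <- iota 0 d].
Proof.
move=> a v u w E u0.
have szE : (size a + (size u + size w).+1 = d)%N.
  by rewrite -(size_iota 0 d) -(size_map profile) E size_cat /= size_cat.
have nthE i : (i < d)%N -> nth 0 (a ++ v :: u ++ w) i = profile i.
  by move=> id; rewrite -E (nth_map 0%N) ?size_iota // nth_iota.
have -> : v = profile (size a).
  by rewrite -nthE ?nth_cat ?ltnn ?subnn //; lia.
have -> : \sum_(z <- u) z = \sum_(i < size u) profile (size a + i.+1).
  rewrite (big_nth 0) big_mkord; apply: eq_bigr => i _.
  have iu := ltn_ord i.
  rewrite -nthE; last first.
    by rewrite -szE ltn_add2l ltnS (leq_trans iu) ?leq_addr.
  by rewrite nth_cat ltnNge leq_addr /= addKn /= nth_cat iu.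
have : (0 < size u)%N by rewrite lt0n size_eq0.
by move=> u0'; apply: profile_step => //; lia.
Qed.

Lemma profile_prefix p q : [seq profile i | i <- iota 0 d] = p ++ q ->
  (profile 0 - 1) * (size p)%:R <= \sum_(v <- p) v.
Proof.
case: p => [|v p] E; first by rewrite big_nil mulr0.
have vE : v = profile 0 by case: d d2 E => // d' _ [].
rewrite big_cons /= -natr1 -vE.
have [->|p0] := eqVneq p [::]; first by rewrite big_nil /=; lra.
have := profile_balanced; rewrite E => /(_ [::] v p q erefl p0); lra.
Qed.

(** Passing from [m = profile 0 - 1] to [profile 0] costs 1 per index, which is the summand
    [#|I|]. *)
Lemma profile_subset_sum (I : {set 'I_d}) : I != set0 ->
  \sum_(i in I) (profile 0 - profile i) <= #|I|%:R * (1 + ln (d%:R / #|I|%:R)).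
Proof.
move=> I0.
have E : [seq profile i | i <- iota 0 d] = [seq profile (val i) | i <- enum 'I_d].
  by rewrite -val_enum_ord -map_comp.
have := @balanced_subset_sum R d (fun i => profile i) I (profile 0 - 1).
rewrite -E => /(_ profile_balanced profile_prefix I0) h.
rewrite mulrDr mulr1 -lerBlDl; apply: le_trans h.
rewrite -sumr_const -sumrB; apply: ler_sum => i _; lra.
Qed.

End HKZProfile.

(** This is [1 + u <= expR u] at [u = ln (x / k) - 1]. *)
Lemma mul_ln_div_le (R : realType) (x k : R) : 0 < x -> 0 < k ->
  k * ln (x / k) <= x / expR 1.
Proof.
move=> x0 k0; have t0 : 0 < x / k by apply: divr_gt0.
have := expR_ge1Dx (ln (x / k) - 1).
rewrite expRD lnK ?posrE // expRN => h.
have -> : x / expR 1 = k * (x / k / expR 1).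
  by field; rewrite !gt_eqF // expR_gt0.
rewrite ler_pM2l //; lra.
Qed.

Theorem theorem3 (R : realType) (n d : nat) (b : nat -> 'rV[R]_n)
    (I : {set 'I_d}) :
  (2 <= d)%N ->
  lin_indep d b ->
  HKZ d b ->
  I != set0 ->
  normv (b 0%N) ^+ #|I| / \prod_(i in I) normv (gs b i)
    <= Num.sqrt (d%:R : R) `^ (#|I|%:R * (1 + ln (d%:R / #|I|%:R)))
  /\ Num.sqrt (d%:R : R) `^ (#|I|%:R * (1 + ln (d%:R / #|I|%:R)))
    <= Num.sqrt (d%:R : R) `^ (d%:R / expR 1 + #|I|%:R).
Proof.
move=> d2 li hkz I0.
have gsn0 i : (i < d)%N -> gs b i != 0 by exact: lin_indep_gs_neq0.
have d0 : 0 < d%:R :> R by rewrite ltr0n; lia.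
have k0 : 0 < #|I|%:R :> R by rewrite ltr0n card_gt0.
have L0 := lnd_gt0 R d2.
have s0 : 0 < Num.sqrt (d%:R : R) by rewrite sqrtr_gt0.
have lns : ln (Num.sqrt (d%:R : R)) = ln d%:R / 2.
  by rewrite -powR12_sqrt ?ler0n // ln_powR mulrC.
split; last first.
  rewrite ler_powR //; last first.
    by rewrite mulrDr mulr1 addrC lerD2r mul_ln_div_le.
  by rewrite -[X in X <= _]sqrtr1 ler_wsqrtr // ler1n; lia.
have N0 i : (i < d)%N -> 0 < normv (gs b i).
  by move=> id; rewrite sqrtr_gt0 lt_neqAle dotv_ge0 eq_sym dotv_eq0 gsn0.
have lnN i : (i < d)%N -> ln (normv (gs b i)) = ln d%:R / 2 * profile d b i.
  move=> id; rewrite /profile /normv -powR12_sqrt ?dotv_ge0 // ln_powR.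
  by field; rewrite gt_eqF.
have P0 : 0 < \prod_(i in I) normv (gs b i) by apply: prodr_gt0 => i _; apply: N0.
have b0 : 0 < normv (gs b 0) by apply: N0; lia.
(* In logarithms both sides share the factor [ln d / 2], which leaves the inequality on the
   profile. *)
rewrite -gs0 -ler_ln ?posrE ?divr_gt0 ?exprn_gt0 ?powR_gt0 //.
rewrite ln_powR lns ln_div ?posrE ?exprn_gt0 // lnXn // ln_prod; last first.
  by move=> i _; apply: N0.
rewrite -sumr_const -sumrB.
under eq_bigr => i _ do rewrite !lnN ?(ltnW d2) // -mulrBr.
rewrite -mulr_sumr mulrC ler_pM2r ?divr_gt0 //.
exact: profile_subset_sum.
Qed.
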